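(* 1. A set system $(X,\mathcal{F})$ is self-and-dual extremal if and only if it is self-and-dual well-graded, if and only if it is a full-chain system or an upward-starlike system or a downward-starlike system. 2. A set system $(X,\mathcal{F})$ is self-and-dual maximum if and only if either $|\mathcal{F}|=1$ or $\mathcal{F}=\{\emptyset,X\}$.
   Context: A set system $(X,\mathcal{F})$ is a finite set $X$ (the domain) together with a nonempty family $\mathcal{F}$ of distinct subsets of $X$. Its one-inclusion graph $G_{\mathcal{F}}$ is the edge-labelled directed graph with one vertex $v_A$ for each $A\in\mathcal{F}$ and a directed edge from $v_A$ to $v_B$ with label $b$ whenever $B=A\cup\{b\}$ for some $b\in X\setminus A$. For directed graphs, connectedness, being a tree, distances $d_G$ and degrees refer to the underlying undirected graph (infinite distance if there is no path). The system is well-graded if $|A\triangle B|=d_{G_{\mathcal{F}}}(v_A,v_B)$ for all $A,B\in\mathcal{F}$. $Y\subseteq X$ is shattered if $\mathcal{F}\cap Y:=\{A\cap Y:A\in\mathcal{F}\}$ is the full power set of $Y$; the VC-dimension is the largest size of a shattered set. $Y$ is strongly shattered if there is $T\subseteq X\setminus Y$ with $\{Z\cup T:Z\subseteq Y\}\subseteq\mathcal{F}$. The system is extremal if the shattered sets and the strongly shattered sets coincide. The system, with VC-dimension $d$, is maximum if $|\mathcal{F}\cap Y|=\sum_{i=0}^d\binom{|Y|}{i}$ for every $Y\subseteq X$. Dual system: $Y_{\mathcal{F}}=\{y_A:A\in\mathcal{F}\}$ with distinct symbols $y_A$ for distinct $A$; for $x\in X$, $\mathcal{A}_x=\{y_A:A\in\mathcal{F},\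 x\in A\}$; $\mathcal{F}^*=\{\mathcal{A}_x:x\in X\}$ (as a set, without multiplicities). The dual system of $(X,\mathcal{F})$ is $(Y_{\mathcal{F}},\mathcal{F}^* )$. A set system is called self-and-dual well-graded (respectively self-and-dual extremal, self-and-dual maximum) if both the system itself and its dual system are well-graded (respectively extremal, maximum). $(X,\mathcal{F})$ is a full-chain system if the members of $\mathcal{F}$ can be ordered as $A_1\subseteq A_2\subseteq\dots\subseteq A_n$ with $|A_i\setminus A_{i-1}|=1$ for $2\le i\le n$ (length $n\geq1$ allowed; the domain may contain elements belonging to every or to no member). In a connected directed graph $G$, a vertex $v$ is a source if every edge, directed from $w$ to $z$, satisfies $d_G(w,v)<d_G(z,v)$; it is a sink if every edge, directed from $w$ to $z$, satisfies $d_G(w,v)>d_G(z,v)$. An edge-labelled directed tree is starlike if all its edge labels are distinct and it has a distinguished vertex $v_0$ (the centre) of degree at least $2$ which is a source or a sink, while all other vertices have degree at most $2$. $(X,\mathcal{F})$ is upward-starlike if $G_{\mathcal{F}}$ is starlike, $\emptyset\in\mathcal{F}$, $v_\emptyset$ is the centre and a source of $G_{\mathcal{F}}$, and some element of $X$ belongs to no member of $\mathcal{F}$. It is downward-starlike if $G_{\mathcal{F}}$ is starlike, $X\in\mathcal{F}$, $v_X$ is the centre and a sink of $G_{\mathcal{F}}$, and some element of $X$ belongs to every member of $\mathcal{F}$.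
   Formalization: In part 2 the alternative F = {∅, X} is required to have |X| = 1: for |X| ≥ 2 the system {∅, X} has VC-dimension 1 but only 2 < 1+|X| members, so it is not maximum and the claim as written fails. *)

(* Defs.v *)
From mathcomp Require Import all_boot.

Set Implicit Arguments.
Unset Strict Implicit.
Unset Printing Implicit Defensive.

(* A digraph is its arc relation [g : rel V]; an edge-labelled digraph is a
   relation [e : V -> V -> pred L], where [e v w b] means that there is an edge
   from [v] to [w] with label [b]. Digraphs are meant to have no loops and no
   pair of opposite arcs, as is the case for one-inclusion graphs. *)

Section Digraph.
Variables (V : finType) (g : rel V).

Definition adj : rel V := fun v w => g v w || g w v.

Definition connected : Prop := forall v w : V, connect adj v w.

Definition acyclic : Prop :=
  forall c : seq V, cycle adj c -> uniq c -> size c <= 2.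

Definition tree : Prop := connected /\ acyclic.

Definition degree (v : V) : nat := #|[set w | adj v w]|.

Definition walk (v w : V) (n : nat) : Prop :=
  exists p : seq V, [/\ path adj v p, last v p = w & size p = n].

(* The distance as a relation: an infinite distance equals no [n : nat]. *)
Definition dist (v w : V) (n : nat) : Prop :=
  walk v w n /\ forall m, walk v w m -> n <= m.

Definition source (v : V) : Prop :=
  connected /\
  forall w z m n, g w z -> dist w v m -> dist z v n -> m < n.

Definition sink (v : V) : Prop :=
  connected /\
  forall w z m n, g w z -> dist w v m -> dist z v n -> n < m.

End Digraph.

Section LabelledDigraph.
Variables (V L : finType) (e : V -> V -> pred L).

Definition arc : rel V := fun v w => [exists b, e v w b].

Definition distinct_labels : Prop :=
  forall v w v' w' b, e v w b -> e v' w' b -> v = v' /\ w = w'.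

Definition starlike_at (v0 : V) : Prop :=
  [/\ tree arc, distinct_labels, 2 <= degree arc v0,
      source arc v0 \/ sink arc v0
    & forall v, v != v0 -> degree arc v <= 2].

End LabelledDigraph.

(* A set system with domain [X] is a family [F : {set {set X}}] with
   [F != set0]. The predicates below make sense for every family. *)

Section SetSystem.
Variables (X : finType) (F : {set {set X}}).

Definition vertex : finType := {A : {set X} | A \in F}.

Definition one_inclusion (A B : vertex) : pred X :=
  fun b => (b \notin val A) && (val B == b |: val A).

Definition well_graded : Prop :=
  forall A B : vertex,
    dist (arc one_inclusion) A B
      #|(val A :\: val B) :|: (val B :\: val A)|.

Definition trace (Y : {set X}) : {set {set X}} := [set A :&: Y | A in F].

Definition shattered (Y : {set X}) : bool := trace Y == powerset Y.

Definition strongly_shattered (Y : {set X}) : bool :=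
  [exists T : {set X},
    (T \subset ~: Y) && ([set Z :|: T | Z in powerset Y] \subset F)].

Definition extremal : Prop :=
  forall Y : {set X}, shattered Y = strongly_shattered Y.

Definition has_vc_dim (d : nat) : Prop :=
  (exists2 Y, shattered Y & #|Y| = d) /\
  forall Y, shattered Y -> #|Y| <= d.

(* A nonempty family has exactly one VC-dimension. The empty family, which
   occurs only as the dual of a system with empty domain, has none and counts
   as maximum; this is the convention that its VC-dimension is -1. *)
Definition maximum : Prop :=
  forall d, has_vc_dim d ->
    forall Y : {set X}, #|trace Y| = \sum_(0 <= i < d.+1) 'C(#|Y|, i).

(* The symbol y_A is the vertex [A] itself. *)
Definition dual_system : {set {set vertex}} :=
  [set [set A : vertex | x \in val A] | x in [set: X]].

Definition full_chain : Prop :=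
  exists s : seq {set X},
    perm_eq s (enum F) /\
    sorted (fun A B : {set X} => (A \subset B) && (#|B :\: A| == 1)) s.

Definition upward_starlike : Prop :=
  (exists v : vertex,
     [/\ val v = set0, starlike_at one_inclusion v
       & source (arc one_inclusion) v]) /\
  exists x : X, forall A, A \in F -> x \notin A.

Definition downward_starlike : Prop :=
  (exists v : vertex,
     [/\ val v = setT, starlike_at one_inclusion v
       & sink (arc one_inclusion) v]) /\
  exists x : X, forall A, A \in F -> x \in A.

End SetSystem.

Definition self_and_dual (P : forall X : finType, {set {set X}} -> Prop)
    (X : finType) (F : {set {set X}}) : Prop :=
  P X F /\ P (vertex F) (dual_system F).

(* Main.v *)
Require Import Defs.
From mathcomp Require Import all_boot.

(* Write the system as a boolean incidence matrix, rows for members and columns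
   for elements. Well-gradedness says that from each row one can step, changing a
   single entry, towards any different row, and the dual system is given by the
   transposed matrix. If the columns are graded, two row edges with the same
   label coincide, and a row with two outgoing (or two incoming) edges is
   constant. Two incomparable rows force such a turn somewhere on the way between
   them; so either the rows form a chain, or there are a constant row and, by
   the same argument on columns, a constant column with the same value, and all
   other rows have at most two neighbours: the starlike case.
   An extremal system has as many members as shattered sets (each half of the
   system obeys the corresponding inequalities), a property inherited by
   subcubes, which yields well-gradedness. Conversely, if both systems are
   well-graded, uniqueness of labels excludes shattered pairs, and for
   VC-dimension at most one well-gradedness gives extremality.
   Finally, a maximum system of positive VC-dimension has more members than its
   domain has elements, so the system and its dual cannot both be of that kind. *)

Set Implicit Arguments.
Unset Strict Implicit.
Unset Printing Implicit Defensive.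

(** * Graded incidence matrices *)

(** The exclusive or leaves the direction of the edge open: [c] may be gained or lost. *)
Definition step (R C : finType) (M : R -> C -> bool) (r t : R) (c : C) : Prop :=
  forall d, M t d = M r d (+) (d == c).

(** Local form of well-gradedness. Rows may be repeated, so it applies directly to the transpose,
    where different elements can have the same column. *)
Definition graded (R C : finType) (M : R -> C -> bool) : Prop :=
  forall r s c0, M r c0 != M s c0 ->
    exists t c, step M r t c /\ M t c = M s c.

Definition transpose (R C : finType) (M : R -> C -> bool) : C -> R -> bool :=
  fun c r => M r c.

Definition xor_const (R C : finType) (b : bool) (M : R -> C -> bool) :
  R -> C -> bool := fun r c => M r c (+) b.

Section Step.
Variables (R C : finType) (M : R -> C -> bool).

Lemma stepE r t c : step M r t c -> M t c = ~~ M r c.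
Proof. by move=> /(_ c) ->; rewrite eqxx addbT. Qed.

Lemma step_neq r t c d : step M r t c -> d != c -> M t d = M r d.
Proof. by move=> /(_ d) -> /negPf ->; rewrite addbF. Qed.

Lemma step_sym r t c : step M r t c -> step M t r c.
Proof. by move=> rt d; rewrite rt -addbA addbb addbF. Qed.

Lemma step_xor b r t c : step (xor_const b M) r t c <-> step M r t c.
Proof.
by split=> rt d; move: (rt d); rewrite /xor_const; case: (M t d) (M r d) (d == c) b {rt} => [] [] [] [].
Qed.

Lemma graded_xor b : graded (xor_const b M) <-> graded M.
Proof.
split=> gM r s c0.
  move=> rs; have [|t [c [/step_xor rt e]]] := gM r s c0.
    by apply: contraNneq rs => /addIb ->.
  by exists t, c; split=> //; apply: (@addIb b).
rewrite /xor_const => rs; have [|t [c [rt e]]] := gM r s c0.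
  by apply: contraNneq rs => ->.
by exists t, c; split; [apply/step_xor | rewrite e].
Qed.

Definition hdist r s := #|[pred d | M r d != M s d]|.

Lemma hdist_step r t s c : step M r t c -> M t c = M s c ->
  hdist r s = (hdist t s).+1.
Proof.
move=> rt tc; have rc := stepE rt.
rewrite /hdist (cardD1 c) inE -tc rc; case: (M r c) => /=; rewrite add1n;
  congr _.+1; apply: eq_card => d; rewrite !inE;
  by have [->|ndc] := eqVneq d c; rewrite ?tc ?eqxx // (step_neq rt).
Qed.

Lemma hdist_le_step r t s c : step M r t c -> hdist r s <= (hdist t s).+1.
Proof.
move=> rt; have [e|ne] := eqVneq (M t c) (M s c); first by rewrite (hdist_step rt e).
rewrite (hdist_step (step_sym rt) (s := s)) 1?ltnW //.
by move: ne; rewrite (stepE rt); case: (M r c) (M s c) => [] [].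
Qed.

Lemma hdist0 r s : hdist r s = 0 -> M r =1 M s.
Proof. by move/card0_eq=> rs d; move: (rs d); rewrite !inE => /negbFE/eqP. Qed.

End Step.

Section Matrix.
Variables (R C : finType) (M : R -> C -> bool).

(** Walk from [r] towards [s]: only columns in which the two differ are ever changed, and the edge
    sought is the one that flips column [a]. *)
Lemma graded_edge r s a : graded M -> M r a != M s a ->
  exists u v, [/\ step M u v a, M u a = M r a
    & forall d, M r d = M s d -> M u d = M r d].
Proof.
move=> gM; have [n] := ubnP (hdist M r s).
elim: n r => // n IHn r le_n rs.
have [t [c [rt tc]]] := gM _ _ _ rs.
have [eca | nca] := eqVneq c a.
  by subst c; exists r, t; split.
have ta : M t a = M r a by rewrite (step_neq rt) // eq_sym.
have [||u [v [uv ua uag]]] := IHn t; last first.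
- exists u, v; split=> // [|d rsd]; first by rewrite ua.
  have ndc : d != c by apply/eqP=> e; subst d; move: (stepE rt); rewrite tc rsd; case: (M s c).
  by rewrite uag (step_neq rt).
- by rewrite ta.
by move: le_n; rewrite (hdist_step rt tc).
Qed.

(** If the rows differed in [c'], a first step from column [c] towards column [c'] would reach a
    column [d] that differs from [c] in a single row [r]. Column [d] does not change along an edge
    labelled [c], so both edges contain [r], and they do so on the same side. *)
Lemma graded_label r0 r1 s0 s1 c : graded (transpose M) ->
  step M r0 r1 c -> step M s0 s1 c -> M r0 c = M s0 c -> M r0 =1 M s0.
Proof.
move=> gT r01 s01 e c'; apply/eqP/negPn/negP => ne.
have ncc : c' != c by apply: contraNneq ne => ->; rewrite e.
have [x cx] : exists x, transpose M c x != transpose M c' x.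
  rewrite /transpose; have [e0|] := eqVneq (M r0 c) (M r0 c'); last by exists r0.
  by exists r1; rewrite (stepE r01) (step_neq r01 ncc) -e0; case: (M r0 c).
have [d [r [cd _]]] := gT _ _ _ cx.
have ndc : d != c.
  by apply/eqP=> edc; move: (stepE cd); rewrite edc; case: (transpose M c r).
have hr x0 x1 : step M x0 x1 c -> (x0 == r) || (x1 == r).
  move=> x01; move: (cd x0) (cd x1); rewrite /transpose (step_neq x01 ndc) (stepE x01).
  by case: (x0 == r) (x1 == r) (M x0 d) (M x0 c) => [] [] [] [].
have := hr _ _ r01; have := hr _ _ s01.
case/orP=> /eqP e1; case/orP=> /eqP e2.
- by move: ne; rewrite e1 e2 eqxx.
- by move: (stepE r01); rewrite e2 -e1 e; case: (M s0 c).
- by move: (stepE s01); rewrite e1 -e2 e; case: (M s0 c).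
by move: ne; rewrite -(step_neq r01 ncc) -(step_neq s01 ncc) e1 e2 eqxx.
Qed.

(** VC-dimension at most one; the two indices of a row are its entries in columns [a] and [b]. *)
Definition no_shattered_pair := forall a b r00 r01 r10 r11, a != b ->
  [/\ ~~ M r00 a, ~~ M r01 a, M r10 a & M r11 a] ->
  ~ [/\ ~~ M r00 b, M r01 b, ~~ M r10 b & M r11 b].

(** The walks from [r00] to [r10] and from [r01] to [r11] cross edges labelled [a] whose lower ends
    differ in [b], against [graded_label]. *)
Lemma graded_no_shattered_pair :
  graded M -> graded (transpose M) -> no_shattered_pair.
Proof.
move=> gM gT a b r00 r01 r10 r11 nab [/negPf a00 /negPf a01 a10 a11] [/negPf b00 b01 /negPf b10 b11].
have [|u [v [uv ua uag]]] := @graded_edge r00 r10 a gM; first by rewrite a00 a10.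
have [|u' [v' [uv' ua' uag']]] := @graded_edge r01 r11 a gM; first by rewrite a01 a11.
have eu : M u a = M u' a by rewrite ua ua' a00 a01.
by move: (graded_label gT uv uv' eu b); rewrite uag ?uag' ?b00 ?b01 ?b10 ?b11.
Qed.

(* Column [a] can only leave the rows [m], [m1], [m2] at [m1], so no step from
   it leads towards a column taking the other value on all three rows. *)
Lemma graded_turn m m1 m2 a b : graded (transpose M) ->
  step M m m1 a -> step M m m2 b -> a != b -> M m a = M m b ->
  forall c, M m c = M m a.
Proof.
move=> gT s1 s2 nab eab c; apply/eqP/negPn/negP=> nc.
have [d [r [ad dr]]] := gT a c m (etrans (congr1 negb (eq_sym _ _)) nc).
have nca : c != a by apply: contraNneq nc => ->.
have nda : d != a.
  by apply/eqP=> e; move: (stepE ad); rewrite e; case: (transpose M a r).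
have hm := ad m; have hm1 := ad m1; have hm2 := ad m2.
rewrite /transpose (step_neq s1 nda) (stepE s1) in hm1; rewrite /transpose in hm dr.
have [em1 | nm1] := eqVneq m1 r.
  move: dr; rewrite -em1 (step_neq s1 nda) (step_neq s1 nca) hm1 em1 eqxx.
  by move: nc; case: (M m a) (M m c) => [] [].
rewrite (negPf nm1) addbF in hm1; have em : m = r.
  by apply/eqP; move: hm; rewrite hm1; case: (M m a) (m == r) => [] [].
have nm2 : m2 != r by apply/eqP=> e; move: (stepE s2); rewrite e em; case: (M r b).
have nba : b != a by rewrite eq_sym.
rewrite /transpose (step_neq s2 nab) (negPf nm2) addbF in hm2.
have [edb|ndb] := eqVneq d b.
  by move: hm1; rewrite edb -eab; case: (M m a).
by move: hm1 hm2; rewrite (step_neq s2 ndb) => ->; case: (M m a).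
Qed.

Definition turn m m1 m2 a b :=
  [/\ step M m m1 a, step M m m2 b, a != b & M m a = M m b].

(** On the way from [r] to [s] entries have to be flipped in both directions; where the direction
    changes, the walk has a turn. *)
Lemma incomparable_turn r s x y : graded M ->
  M r x != M s x -> M r y != M s y -> M r x != M r y ->
  exists m m1 m2 a b, turn m m1 m2 a b.
Proof.
move=> gM; have [n] := ubnP (hdist M r s).
elim: n r x y => // n IHn r x y le_n rx ry rxy.
have [t [c [rt tc]]] := gM _ _ _ rx; have rc := stepE rt.
have ltn : hdist M t s < n by move: le_n; rewrite (hdist_step rt tc).
(* Column [z] still has to be flipped, in the direction opposite to that of [c]. Once [t] and [s]
   are comparable, the next flip goes the way of [z], so the walk turns at [t]. *)
have [z rz rzc] : exists2 z, M r z != M s z & M r z != M r c.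
  have [e|] := eqVneq (M r x) (M r c); last by exists x.
  by exists y => //; rewrite -e eq_sym.
have nzc : z != c by apply: contraNneq rzc => ->.
have tz : M t z = M r z by rewrite (step_neq rt).
have [/existsP[w /andP[tw twz]]|/existsPn nw] :=
    boolP [exists w, (M t w != M s w) && (M t w != M t z)].
  by apply: (IHn t w z) => //; rewrite tz.
have tsz : M t z != M s z by rewrite tz.
have [u [d [td ud]]] := gM _ _ _ tsz.
have tsd : M t d != M s d by rewrite -ud (stepE td); case: (M t d).
have /eqP tdz : M t d == M t z by move: (nw d); rewrite tsd negbK.
exists t, r, u, c, d; split=> //; first exact: step_sym.
  by apply: contraNneq tsd => <-; rewrite tc.
by rewrite tdz tz rc; move: rzc; case: (M r z) (M r c) => [] [].
Qed.
End Matrix.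

(** * Chains and stars are graded in both directions *)

Section Chain.
Variables (R C : finType) (M : R -> C -> bool).

Definition row_inj := forall r s, M r =1 M s -> r = s.

Definition row_chain := forall r s, M r \subset M s \/ M s \subset M r.

(** Take the largest row [r] that has [y] but not [x]. Column [x] consists of the rows strictly
    above [r]; adding [r] gives the column of the element lost by stepping down from [r], or column
    [y] itself if [r] is the least row. *)
Lemma chain_step_up x y r0 : row_inj -> row_chain -> graded M ->
  ~~ M r0 x -> M r0 y ->
  exists z r, step (transpose M) x z r /\ M r z = M r y.
Proof.
move=> inj ch gM x0 y0.
have P0 : [pred r | ~~ M r x && M r y] r0 by rewrite /= x0 y0.
case: (arg_maxnP (fun r => #|M r|) P0) => r /andP[rx ry] rmax.
have row_eq q : M r \subset M q -> M q \subset M r -> q = r.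
  move=> rq qr; apply: inj => c.
  by apply/idP/idP; [move/(subsetP qr) | move/(subsetP rq)].
have above q : q != r -> M r \subset M q -> M q x.
  move=> nqr rq; apply: contraNT nqr => qx.
  have qy : M q y by apply: (subsetP rq).
  have le_qr : #|M q| <= #|M r| by apply: rmax; rewrite /= qx qy.
  have [le] := subset_leqif_card rq; rewrite eqn_leq le le_qr => /esym qr.
  by apply/eqP/row_eq.
have [/existsP[s /subsetPn[c rc sc]] | /existsPn low] :=
    boolP [exists s, ~~ (M r \subset M s)]; last first.
  exists y, r; split=> // q; rewrite /transpose.
  have rq : M r \subset M q by have := low q; rewrite negbK.
  have -> : M q y by apply: (subsetP rq).
  by have [->|nqr] := eqVneq q r; [rewrite (negPf rx) | rewrite (above q)].
rewrite !unfold_in in rc sc.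
have sr : M s \subset M r.
  by case: (ch r s) => // /subsetP/(_ c rc); rewrite unfold_in (negPf sc).
have [|t [z [rt tz]]] := gM r s c; first by rewrite (negPf sc) rc.
have rz : M r z.
  apply: contraT => rz; have : M s z by rewrite -tz (stepE rt).
  by move/(subsetP sr)=> /idPn; case.
have tz' : ~~ M t z by rewrite (stepE rt) rz.
exists z, r; split; last by rewrite rz ry.
move=> q; rewrite /transpose; have [->|nqr] := eqVneq q r; first by rewrite rz (negPf rx).
rewrite addbF; case: (ch r q) => [rq | qr].
  by rewrite (above q) //; apply: (subsetP rq).
have -> : M q x = false by apply: contraNF rx => /(subsetP qr).
apply: contraNF nqr => qz; apply/eqP/row_eq => //.
have tq : M t \subset M q.
  by case: (ch t q) => // /subsetP/(_ z qz) /(negP tz').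
apply/subsetP=> d rd; have [->//|ndz] := eqVneq d z.
by apply: (subsetP tq); rewrite unfold_in (step_neq rt).
Qed.
End Chain.

(** If [r0] has [x] and not [y], complementing all entries reverses the chain and leads back to the
    case of [chain_step_up]. *)
Lemma chain_graded_transpose (R C : finType) (M : R -> C -> bool) :
  row_inj M -> row_chain M -> graded M -> graded (transpose M).
Proof.
move=> inj ch gM x y r0; rewrite /transpose => ne.
case r0y: (M r0 y) ne => r0x.
  have {}r0x : ~~ M r0 x by case: (M r0 x) r0x.
  have [z [r [xz e]]] := chain_step_up inj ch gM r0x r0y.
  by exists z, r.
have [|||||z [r [xz e]]] := @chain_step_up _ _ (xor_const true M) x y r0.
- by move=> r s rs; apply: inj => c; apply: (@addIb true); apply: rs.
- move=> r s; case: (ch r s) => /subsetP rs; [right | left]; apply/subsetP=> c;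
  by rewrite !unfold_in /xor_const !addbT; apply: contra; apply: rs.
- exact/graded_xor.
- by move: r0x; rewrite /xor_const; case: (M r0 x).
- by rewrite /xor_const r0y.
exists z, r; split; first exact/(step_xor (transpose M) true).
exact: (@addIb true).
Qed.


(** * Star matrices: an empty row as centre and an empty column *)

Section StarMatrix.
Variables (R C : finType) (M : R -> C -> bool) (m : R) (z : C).
Hypothesis inj : row_inj M.
Hypothesis row0 : forall c, ~~ M m c.
Hypothesis col0 : forall r, ~~ M r z.
(** [acc] will come from connectedness with source [m], [lab] from distinct labels, and [up] from
    the degree bound, one edge of [v] being the one back towards [m]. *)
Hypothesis acc : forall v, v != m -> exists u x, step M u v x /\ ~~ M u x.
Hypothesis lab : forall u v u' v' x, step M u v x -> step M u' v' x ->
  ~~ M u x -> ~~ M u' x -> v = v'.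
Hypothesis up : forall v u u' x x', v != m -> step M v u x -> step M v u' x' ->
  ~~ M v x -> ~~ M v x' -> u = u'.

Lemma step_sub u v x : step M u v x -> ~~ M u x -> M u \subset M v.
Proof.
move=> uv ux; apply/subsetP=> d ud; rewrite unfold_in (step_neq uv) //.
by apply: contraNneq ux => <-.
Qed.

Lemma step_card u v x : step M u v x -> ~~ M u x -> #|M v| = #|M u|.+1.
Proof.
move=> uv ux; rewrite (cardD1 x) unfold_in (stepE uv) ux add1n; congr _.+1.
apply: eq_card => d; rewrite !inE unfold_in; have [->|ndx] /= := eqVneq d x.
  by rewrite (negPf ux).
by rewrite -topredE /= (step_neq uv).
Qed.

(** Descend from [w] by [acc], one element at a time, until [x] is lost. *)
Lemma star_edge w x : M w x -> exists u v,
  [/\ step M u v x, ~~ M u x & M v \subset M w].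
Proof.
have [n] := ubnP #|M w|; elim: n w => // n IHn w le_n wx.
have nwm : w != m by apply: contraTneq wx => ->.
have [u [y [uw uy]]] := acc nwm.
have [exy | nxy] := eqVneq x y.
  by subst y; exists u, w; split.
have ux : M u x by rewrite -(step_neq uw).
have [|u' [v' [uv' ux' sub]]] := IHn u _ ux.
  by rewrite -ltnS; apply: leq_trans le_n; rewrite (step_card uw uy).
by exists u', v'; split=> //; apply: subset_trans sub (step_sub uw uy).
Qed.

Lemma star_through u v x w : step M u v x -> ~~ M u x -> M w x -> M v \subset M w.
Proof.
move=> uv ux /star_edge[u' [v' [uv' ux' sub]]].
by rewrite (lab uv uv' ux ux').
Qed.

(** Descend from [w]: an element [y] lost on the way is not in [v], as otherwise [star_through]
    would put [w] below [v]. So the descent stays above [v] until it arrives there. *)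
Lemma star_up v w x : M v \subset M w -> ~~ M v x -> M w x ->
  exists t y, [/\ step M v t y, ~~ M v y & M w y].
Proof.
have [n] := ubnP #|M w|; elim: n w x => // n IHn w x le_n vw vx wx.
have nwm : w != m by apply: contraTneq wx => ->.
have [u [y [uw uy]]] := acc nwm.
have wy : M w y by rewrite (stepE uw).
have vy : ~~ M v y.
  apply/negP=> vy; have /subsetP/(_ x) := star_through uw uy vy.
  by rewrite !unfold_in wx (negPf vx) => /(_ isT).
have vu : M v \subset M u.
  apply/subsetP=> d vd; have ndy : d != y by apply: contraNneq vy => <-.
  by rewrite unfold_in -(step_neq uw ndy); apply: (subsetP vw).
have [/existsP[d /andP[ud vd]] | /existsPn nd] := boolP [exists d, M u d && ~~ M v d].
  have [|t [y' [vt vy' uy']]] := IHn u d _ vu vd ud.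
    by rewrite -ltnS; apply: leq_trans le_n; rewrite (step_card uw uy).
  by exists t, y'; split=> //; apply: (subsetP (step_sub uw uy)).
have -> : v = u.
  apply: inj => d; apply/idP/idP; first by move/(subsetP vu).
  by move=> ud; move: (nd d); rewrite ud negbK.
by exists w, y; split.
Qed.

(** If [v] is not below [w], go back along the edge entering [v]: every row with its label lies
    above [v]. *)
Lemma star_graded : graded M.
Proof.
move=> v w c0 ne.
have [vw | /subsetPn[c vc wc]] := boolP (M v \subset M w).
  have [||t [y [vt vy wy]]] := @star_up v w c0 vw.
  - by apply: contra ne => vc; rewrite vc; move: (subsetP vw _ vc); rewrite unfold_in => ->.
  - by move: ne; case: (boolP (M v c0)) => [/(subsetP vw) /[!unfold_in] ->|_] //; case: (M w c0).
  by exists t, y; split=> //; rewrite (stepE vt) vy wy.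
have nvm : v != m by apply: contraTneq vc => ->; rewrite unfold_in.
have [u [x [uv ux]]] := acc nvm.
exists u, x; split; first exact: step_sym.
rewrite (negPf ux); apply/esym/negbTE; apply: contra wc => wx.
exact: (subsetP (star_through uv ux wx)).
Qed.

Lemma star_col u v x w : step M u v x -> ~~ M u x -> M w x = (M v \subset M w).
Proof.
move=> uv ux; apply/idP/idP; first exact: star_through.
by move/subsetP; apply; rewrite unfold_in (stepE uv).
Qed.

Lemma row_eqP r s : reflect (r = s) ((M r \subset M s) && (M s \subset M r)).
Proof.
apply: (iffP andP) => [[rs sr] | -> //]; apply: inj => c.
by apply/idP/idP; [move/(subsetP rs) | move/(subsetP sr)].
Qed.

(* A column is the set of rows above the upper end of the edge it labels; so one
   moves to the next column by following the edge above or below. *)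
Lemma star_graded_transpose : graded (transpose M).
Proof.
have above u v x w : u != m -> step M u v x -> ~~ M u x ->
    M u \subset M w -> u != w -> M w x.
  move=> num uv ux uw nuw.
  have [d wd ud] : exists2 d, M w d & ~~ M u d.
    by apply/subsetPn; apply: contra nuw => wu; apply/eqP/row_eqP; rewrite uw.
  have [t [y [ut uy wy]]] := star_up uw ud wd.
  have e := up num ut uv uy ux; subst t; have [<- //|nyx] := eqVneq y x.
  by move: (stepE uv); rewrite (step_neq ut) 1?eq_sym // ux (negPf ux).
move=> x y r0; rewrite /transpose => ne.
have [/existsP[r /andP[rx ry]] | /existsPn nxy] := boolP [exists r, M r x && ~~ M r y].
  have [u [v [uv ux vr]]] := star_edge rx.
  have vx : M v x by rewrite (stepE uv).
  have nvm : v != m by apply: contraTneq vx => ->.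
  have vy : ~~ M v y by apply: contra ry => /(subsetP vr).
  have [/existsP[t /existsP[x' /andP[/forallP vt vx']]] | /existsPn nt] :=
    boolP [exists t, exists x', [forall d, M t d == M v d (+) (d == x')] && ~~ M v x'].
    have {}vt : step M v t x' by move=> d; apply/eqP.
    exists x', v; split; last by rewrite (negPf vx') (negPf vy).
    move=> w; have [->|nwv] := eqVneq w v; first by rewrite (negPf vx') vx.
    rewrite addbF; apply/idP/idP.
      move=> wx'; have tw := star_through vt vx' wx'.
      exact: (subsetP (subset_trans (step_sub vt vx') tw)) vx.
    by move=> wx; apply: above vt vx' (star_through uv ux wx) _; rewrite // eq_sym.
  (* No edge goes up from [v], so [v] is the only row of column [x], and the empty column is one
     step away. *)
  exists z, v; split; last by rewrite (negPf (col0 v)) (negPf vy).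
  move=> w; rewrite (negPf (col0 w)); have [->|nwv] := eqVneq w v; first by rewrite vx.
  apply/esym/negbTE; rewrite addbF; apply/negP=> wx.
  have vw := star_through uv ux wx.
  have [d wd vd] : exists2 d, M w d & ~~ M v d.
    by apply/subsetPn; apply: contra nwv => wv; apply/eqP/row_eqP; rewrite wv.
  have [t [x' [vt vx' _]]] := star_up vw vd wd.
  move: (nt t) => /existsPn/(_ x')/negP; apply; rewrite vx' andbT.
  by apply/forallP=> e; rewrite vt.
have {ne} [x0 y0] : ~~ M r0 x /\ M r0 y.
  by move: ne (nxy r0); case: (M r0 x) (M r0 y) => [] [].
have [/existsP[r rx] | /existsPn x_empty] := boolP [exists r, M r x].
  have [u [v [uv ux vr]]] := star_edge rx.
  have vy : M v y by move: (nxy v); rewrite (stepE uv) ux negbK.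
  have uy : M u y.
    by rewrite -(step_neq uv) //; apply: contraNneq x0 => <-.
  have num : u != m by apply: contraTneq uy => ->.
  (* Rows strictly above [u] pass through [v], so the label of the edge entering [u] has column [x]
     with [u] added. *)
  have [t [x' [tu tx']]] := acc num.
  have ux' : M u x' by rewrite (stepE tu).
  exists x', u; split; last by rewrite ux' uy.
  move=> w; rewrite (star_col w tu tx').
  have [->|nwu] := eqVneq w u; first by rewrite subxx (negPf ux).
  rewrite addbF; apply/idP/idP => [uw | wx].
    by apply: above uv ux uw _; rewrite // eq_sym.
  exact: subset_trans (step_sub uv ux) (star_through uv ux wx).
(* Column [x] is empty. Nothing lies above a largest row [v] having [y], so the label of the edge
   entering [v] has [v] as its only row. *)
case: (@arg_maxnP _ r0 (M^~ y) (fun r => #|M r|) y0) => v vy vmax.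
have nvm : v != m by apply: contraTneq vy => ->.
have [u [x' [uv ux']]] := acc nvm.
exists x', v; split; last by rewrite (stepE uv) ux' vy.
move=> w; rewrite (star_col w uv ux') (negPf (x_empty w)) /=.
apply/idP/idP=> [vw|/eqP-> //].
have wy : M w y by apply: (subsetP vw).
have le_wv : #|M w| <= #|M v| := vmax _ wy.
have [le] := subset_leqif_card vw; rewrite eqn_leq le le_wv => /esym wv.
by apply/eqP/esym/row_eqP; rewrite vw.
Qed.

End StarMatrix.

(** * Set systems and their duals *)

Section DigraphDistance.
Variables (V : finType) (g : rel V).

Lemma dist_uniq v w m n : dist g v w m -> dist g v w n -> m = n.
Proof. by move=> [wm min_m] [wn min_n]; apply/eqP; rewrite eqn_leq min_m ?min_n. Qed.

(** Encoding walks as tuples makes their existence decidable, so that a minimal length can be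
    chosen. *)
Lemma walkP v w n : reflect (walk g v w n)
  [exists p : n.-tuple V, path (adj g) v p && (last v p == w)].
Proof.
apply: (iffP existsP) => [[p /andP[gp /eqP lp]]|[p [gp lp /eqP sp]]].
  by exists p; rewrite size_tuple.
by exists (Tuple sp); rewrite /= gp lp eqxx.
Qed.

Lemma connected_dist v w : connected g -> exists n, dist g v w n.
Proof.
move=> /(_ v w) /connectP[p gp lp].
have ex : exists n, [exists p : n.-tuple V, path (adj g) v p && (last v p == w)].
  by exists (size p); apply/walkP; exists p.
exists (ex_minn ex); case: ex_minnP => n /walkP wn min_n; split=> // m /walkP.
exact: min_n.
Qed.

Lemma dist_step v w n : dist g v w n.+1 -> exists2 u, adj g v u & dist g u w n.
Proof.
case=> -[[|u p] [//= /andP[vu gp] lp [sp]]] min_n; exists u => //; split.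
  by exists p.
move=> m [q [gq lq sq]]; rewrite -ltnS; apply: min_n.
by exists (u :: q); rewrite /= vu gq lq sq.
Qed.

End DigraphDistance.

Local Notation inclusion_graph F := (Defs.arc (@one_inclusion _ F)).

Section Family.
Variables (X : finType) (F : {set {set X}}).

Definition vert A (AF : A \in F) : vertex F := exist (fun A => A \in F) A AF.

Definition inc : vertex F -> X -> bool := fun A x => x \in val A.

Lemma inc_inj : row_inj inc.
Proof. by move=> A B AB; apply/val_inj/setP. Qed.

Lemma one_inclusionP A B b :
  reflect (step inc A B b /\ ~~ inc A b) (one_inclusion A B b).
Proof.
apply: (iffP andP) => [[bA /eqP eB] | [AB bA]]; split=> //.
  move=> d; rewrite /inc eB in_setU1.
  by have [->|] := eqVneq d b; rewrite ?(negPf bA) ?addbF.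
apply/eqP/setP=> d; rewrite in_setU1; have := AB d; rewrite /inc => ->.
rewrite /inc in bA.
by have [->|] := eqVneq d b; rewrite ?(negPf bA) ?addbF.
Qed.

Lemma arcP A B : reflect (exists b, step inc A B b /\ ~~ inc A b)
  (inclusion_graph F A B).
Proof. by apply: (iffP existsP) => -[b /one_inclusionP]; exists b. Qed.

Lemma adjP A B : reflect (exists b, step inc A B b) (adj (inclusion_graph F) A B).
Proof.
apply: (iffP orP) => [[/arcP[b [AB _]] | /arcP[b [BA _]]] | [b AB]].
- by exists b.
- by exists b; apply: step_sym.
have [bA|bA] := boolP (inc A b); [right | left]; apply/arcP; exists b => //.
by split; [apply: step_sym | rewrite (stepE AB) bA].
Qed.

Lemma walk_hdist A B n : walk (inclusion_graph F) A B n -> hdist inc A B <= n.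
Proof.
case=> p [gp <- <-] {n B}; elim: p A gp => [|t p IHp] A /=.
  by move=> _; rewrite leqn0; apply/eqP/eq_card0 => d; rewrite !inE eqxx.
case/andP=> /adjP[c At] /IHp le_p.
exact: leq_trans (hdist_le_step _ At) _.
Qed.

Lemma graded_walk A B : graded inc -> walk (inclusion_graph F) A B (hdist inc A B).
Proof.
move=> gF; move e: (hdist inc A B) => n; elim: n A e => [|n IHn] A e.
  by exists [::]; split=> //=; apply/inc_inj/hdist0.
have /card_gt0P[c] : 0 < hdist inc A B by rewrite e.
rewrite inE => ne; have [t [d [At td]]] := gF _ _ _ ne.
have [|p [gp lp sp]] := IHn t; first by move: e; rewrite (hdist_step At td) => -[].
by exists (t :: p); split=> //=; [rewrite gp andbT; apply/adjP; exists d | rewrite sp].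
Qed.

Lemma graded_dist A B : graded inc -> dist (inclusion_graph F) A B (hdist inc A B).
Proof. by move=> gF; split; [apply: graded_walk | move=> m; apply: walk_hdist]. Qed.

(** For the forward direction: if the first step of a shortest path flipped an entry in which [A]
    and [B] agree, the symmetric difference with [B] would grow, but the distance drops. *)
Lemma well_gradedP : well_graded F <-> graded inc.
Proof.
have hE A B : #|(val A :\: val B) :|: (val B :\: val A)| = hdist inc A B.
  by apply: eq_card => d; rewrite !inE /inc; case: (d \in val A) (d \in val B) => [] [].
split=> [wF A B c ne | gF A B]; last by rewrite hE; apply: graded_dist.
have := wF A B; rewrite hE; case e: (hdist inc A B) => [|n].
  by move: (hdist0 e c) ne => ->; rewrite eqxx.
case/dist_step=> t /adjP[d At] tB; exists t, d; split=> //; apply/eqP/negPn/negP => td.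
have := hdist_step (step_sym At) (s := B); rewrite e.
have := wF t B; rewrite hE => /(dist_uniq tB) <- H.
have /H/eqP : inc A d = inc B d.
  by move: td; rewrite (stepE At); case: (inc A d) (inc B d) => [] [].
by rewrite eqn_leq ltnNge leqnSn andbF.
Qed.

End Family.

Section Dual.
Variables (X : finType) (F : {set {set X}}).

Lemma dual_colP x : [set A : vertex F | x \in val A] \in dual_system F.
Proof. by apply/imsetP; exists x. Qed.

Definition dual_col x : vertex (dual_system F) := vert (dual_colP x).

Lemma dual_col_surj d : exists x, d = dual_col x.
Proof.
have /imsetP[x _ dx] := valP d.
by exists x; apply: val_inj.
Qed.

End Dual.

Lemma inc_dual_col (X : finType) (F : {set {set X}}) x A :
  inc (dual_col F x) A = inc A x.
Proof. by rewrite /inc inE. Qed.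

(** Passing to the dual merges equal columns, and [graded] does not see repetitions. *)
Lemma dual_gradedP (X : finType) (F : {set {set X}}) :
  graded (@inc _ (dual_system F)) <-> graded (transpose (@inc _ F)).
Proof.
split=> gD r s A.
  move=> ne; have [|t [B [rt tB]]] := gD (dual_col F r) (dual_col F s) A.
    by rewrite !inc_dual_col.
  have [x ex] := dual_col_surj t; exists x, B; split=> [d|].
    by have := rt d; rewrite ex !inc_dual_col.
  by move: tB; rewrite ex !inc_dual_col.
have [x ->] := dual_col_surj r; have [y ->] := dual_col_surj s.
rewrite !inc_dual_col => ne; have [z [B [xz zB]]] := gD x y A ne.
exists (dual_col F z), B; rewrite !inc_dual_col; split=> // d.
by rewrite !inc_dual_col; apply: xz.
Qed.

(** * Extremal systems *)

Section Extremal.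
Variable X : finType.
Implicit Types (F : {set {set X}}) (Y Z T : {set X}).

Lemma shatteredP F Y :
  reflect (forall Z, Z \subset Y -> exists2 A, A \in F & A :&: Y = Z) (shattered F Y).
Proof.
apply: (iffP eqP) => [sY Z ZY | sY].
  have : Z \in trace F Y by rewrite sY powersetE.
  by case/imsetP=> A AF ->; exists A.
apply/setP=> Z; rewrite powersetE; apply/imsetP/idP => [[A _ ->]|].
  exact: subsetIr.
by case/sY=> A AF <-; exists A.
Qed.

Lemma strongly_shatteredP F Y :
  reflect (exists2 T : {set X}, T \subset ~: Y & forall Z, Z \subset Y -> Z :|: T \in F)
    (strongly_shattered F Y).
Proof.
apply: (iffP existsP) => [[T /andP[TY /subsetP sF]] | [T TY sF]]; exists T => //.
  by move=> Z ZY; apply/sF/imsetP; exists Z; rewrite ?powersetE.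
rewrite TY; apply/subsetP=> C /imsetP[Z]; rewrite powersetE => /sF ZT ->; exact: ZT.
Qed.

Lemma strongly_shattered_shattered F Y : strongly_shattered F Y -> shattered F Y.
Proof.
case/strongly_shatteredP=> T TY sF; apply/shatteredP=> Z ZY.
exists (Z :|: T); first exact: sF.
rewrite setIUl (setIidPl ZY); move: TY; rewrite -disjoints_subset => /disjoint_setI0 ->.
by rewrite setU0.
Qed.

(** A shattered set has at most one element. For a single [a], a walk from a row without [a] to one
    with [a] crosses an edge labelled [a], whose lower end serves as [T]. *)
Lemma graded_extremal F :
  graded (@inc _ F) -> no_shattered_pair (@inc _ F) -> extremal F.
Proof.
move=> gF vc1 Y; apply/idP/idP; last exact: strongly_shattered_shattered.
move=> /shatteredP sY.
have row Z : Z \subset Y -> exists A : vertex F, forall c, c \in Y -> inc A c = (c \in Z).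
  case/sY=> A AF <-; exists (vert AF) => c cY.
  by rewrite /inc /= inE cY andbT.
have [Y0 | [a aY]] := set_0Vmem Y.
  have [A _] := row _ (sub0set Y); apply/strongly_shatteredP; exists (val A).
    by rewrite Y0 setC0 subsetT.
  by move=> Z; rewrite Y0 subset0 => /eqP->; rewrite set0U (valP A).
have [r0 r0Y] := row _ (sub0set Y).
have [|ra raY] := row [set a]; first by rewrite sub1set.
have Ya : Y = [set a].
  apply/eqP; rewrite eqEsubset sub1set aY andbT; apply/subsetP=> b bY.
  rewrite inE; apply/negPn/negP=> nba.
  have [|rb rbY] := row [set b]; first by rewrite sub1set.
  have [|rab rabY] := row [set a; b]; first by rewrite subUset !sub1set aY.
  have nab : a != b by rewrite eq_sym.
  apply: (vc1 a b r0 rb ra rab nab);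
    by split; rewrite ?r0Y ?raY ?rbY ?rabY ?inE ?eqxx ?orbT // eq_sym.
have [|u [v [uv ua _]]] := @graded_edge _ _ _ r0 ra a gF.
  by rewrite r0Y // raY // !inE eqxx.
rewrite r0Y // in_set0 in ua.
apply/strongly_shatteredP; exists (val u).
  by rewrite Ya; apply/subsetP=> c cu; rewrite !inE; apply: contraFN ua => /eqP <-.
move=> Z; rewrite Ya subset1 => /orP[] /eqP->; last by rewrite set0U (valP u).
have /one_inclusionP/andP[_ /eqP <-] : step (@inc _ F) u v a /\ ~~ inc u a by rewrite ua.
exact: valP v.
Qed.

(** [x] stays in the domain, so both halves are families over the same [X]. *)
Definition half F x b := [set A : {set X} in F | (x \in A) == b].
Definition shattered_sets F := [set Y | shattered F Y].
Definition strongly_shattered_sets F := [set Y | strongly_shattered F Y].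

Lemma card_half F x : #|F| = #|half F x false| + #|half F x true|.
Proof.
rewrite -(cardsID [set A : {set X} | x \in A] F) addnC; congr (_ + _); apply: eq_card => A;
by rewrite !inE; case: (x \in A); rewrite ?andbT ?andbF.
Qed.

Lemma shattered_half_notin F x b Y : shattered (half F x b) Y -> x \notin Y.
Proof.
move/shatteredP=> sY; apply/negP=> xY.
have [A] := sY set0 (sub0set Y); have [B] := sY Y (subxx Y).
rewrite !inE => /andP[_ /eqP xB] eB /andP[_ /eqP xA] eA.
move/setP/(_ x): eA; move/setP/(_ x): eB.
by rewrite !inE xY xA xB; case: b {sY xA xB}.
Qed.

Lemma shatteredS F F' Y : F \subset F' -> shattered F Y -> shattered F' Y.
Proof.
move=> /subsetP FF' /shatteredP sY; apply/shatteredP=> Z /sY[A /FF' AF' eA].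
by exists A.
Qed.

Lemma half_sub F x b : half F x b \subset F.
Proof. by apply/subsetP=> A; rewrite inE => /andP[]. Qed.

(** A set shattered by some half is shattered by [F]; if both halves shatter it, adding [x] gives
    another shattered set, counted separately because it contains [x]. *)
Lemma card_shattered_halves F x :
  #|shattered_sets (half F x false)| + #|shattered_sets (half F x true)|
    <= #|shattered_sets F|.
Proof.
set S0 := shattered_sets _; set S1 := shattered_sets _.
have x0 Y : Y \in S0 -> x \notin Y by rewrite inE => /shattered_half_notin.
have x1 Y : Y \in S1 -> x \notin Y by rewrite inE => /shattered_half_notin.
pose P := [set x |: Y | Y in S0 :&: S1].
have <- : #|S0 :|: S1| + #|P| = #|S0| + #|S1|.
  rewrite card_in_imset ?cardsUI // => Y Z; rewrite !inE => /andP[/shattered_half_notin xY _].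
  by move=> /andP[/shattered_half_notin xZ _] e; rewrite -(setU1K xY) e setU1K.
have dis : [disjoint S0 :|: S1 & P].
  rewrite disjoint_subset; apply/subsetP=> Y YS; apply/negP=> /imsetP[Z _ eY].
  have : x \notin Y by move: YS; rewrite in_setU => /orP[/x0|/x1].
  by rewrite eY !inE eqxx.
have [_ ] := leq_card_setU (S0 :|: S1) P; rewrite dis => /eqP <-.
apply: subset_leq_card; rewrite !subUset; apply/andP; split; [apply/andP; split|].
- by apply/subsetP=> Y; rewrite !inE; apply/shatteredS/half_sub.
- by apply/subsetP=> Y; rewrite !inE; apply/shatteredS/half_sub.
apply/subsetP=> _ /imsetP[Z ZS ->]; have xZ : x \notin Z by case/setIP: ZS => /x0.
have sZ b : shattered (half F x b) Z.
  by move: ZS; rewrite !inE => /andP[]; case: b.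
rewrite inE; apply/shatteredP=> W WZ.
have [|A] := shatteredP _ _ (sZ (x \in W)) (W :\ x); first by rewrite subDset.
rewrite inE => /andP[AF /eqP xA] eA; exists A => //.
apply/setP=> y; move/setP/(_ y): eA; rewrite !inE.
have [->|nyx] /= := eqVneq y x; first by rewrite xA andbT.
by move=> ->.
Qed.

(** A strongly shattered set without [x] belongs to the half selected by [x \in T]. A set with [x],
    once [x] is removed, belongs to both halves, by means of [T] and [x |: T]. *)
Lemma card_strongly_shattered_halves F x :
  #|strongly_shattered_sets F| <=
    #|strongly_shattered_sets (half F x false)| + #|strongly_shattered_sets (half F x true)|.
Proof.
set S0 := strongly_shattered_sets (half _ _ false).
set S1 := strongly_shattered_sets (half _ _ true).
rewrite -(cardsUI S0) -(cardsID [set Y : {set X} | x \in Y]) addnC leq_add //.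
  apply: subset_leq_card; apply/subsetP=> Y; rewrite !inE => /andP[xY].
  case/strongly_shatteredP=> T TY sY.
  have : strongly_shattered (half F x (x \in T)) Y.
    apply/strongly_shatteredP; exists T => // Z ZY; rewrite inE sY //= inE.
    by rewrite (negPf (contra (subsetP ZY x) xY)).
  by case: (x \in T) => ->; rewrite ?orbT.
rewrite -(card_in_imset (f := fun Y => Y :\ x) (D := _ :&: _)); last first.
  by move=> Y Z /=; rewrite !inE => /andP[_ xY] /andP[_ xZ] e; rewrite -(setD1K xY) e setD1K.
apply: subset_leq_card; apply/subsetP=> C /imsetP[Y /setIP[]].
rewrite !inE => /strongly_shatteredP[T TY sY] xY -> {C}.
have xT : x \notin T by apply: contraL xY => /(subsetP TY); rewrite inE.
apply/andP; split; apply/strongly_shatteredP; [exists T | exists (x |: T)].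
- by apply: subset_trans TY _; rewrite setCS subsetDl.
- move=> Z; rewrite subsetD1 => /andP[ZY xZ]; rewrite inE sY //= inE.
  by rewrite (negPf xZ) (negPf xT).
- rewrite subUset sub1set !inE eqxx; apply: subset_trans TY _.
  by rewrite setCS subsetDl.
move=> Z; rewrite subsetD1 => /andP[ZY xZ].
have -> : Z :|: (x |: T) = (x |: Z) :|: T by rewrite setUCA setUA.
by rewrite inE sY ?subUset ?sub1set ?xY // !inE eqxx.
Qed.

Lemma split_family F : 1 < #|F| -> exists x, forall b, #|half F x b| < #|F|.
Proof.
case/card_gt1P=> A [B [AF BF]] nAB.
have [x xAB] : exists x, (x \in A) != (x \in B).
  apply/existsP; rewrite -negb_forall; apply: contra nAB => /forallP AB.
  by apply/eqP/setP=> x; apply/eqP.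
exists x => b; apply: proper_card; rewrite properE half_sub /=.
apply/subsetPn; have [e|ne] := eqVneq (x \in A) b; last by exists A; rewrite // inE AF.
by exists B; rewrite // inE BF /= -e eq_sym.
Qed.

(** Pajor's inequality, by induction over the two halves; with the next lemma it sandwiches [#|F|]
    between the two counts. *)
Lemma card_le_shattered F : #|F| <= #|shattered_sets F|.
Proof.
have [n] := ubnP #|F|; elim: n F => // n IHn F le_n.
have [/split_family[x lt_half]|] := ltnP 1 #|F|.
  rewrite (card_half F x); apply: leq_trans (card_shattered_halves F x).
  by rewrite leq_add // IHn // (leq_trans (lt_half _)).
have [->|[A AF] le1] := set_0Vmem F; first by rewrite cards0.
apply: leq_trans le1 _; apply/card_gt0P; exists set0; rewrite inE.
by apply/shatteredP=> Z; rewrite subset0 => /eqP->; exists A; rewrite ?setI0.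
Qed.

Lemma card_strongly_shattered_le F : #|strongly_shattered_sets F| <= #|F|.
Proof.
have [n] := ubnP #|F|; elim: n F => // n IHn F le_n.
have [/split_family[x lt_half]|le1] := ltnP 1 #|F|.
  rewrite (card_half F x); apply: leq_trans (card_strongly_shattered_halves F x) _.
  by rewrite leq_add // IHn // (leq_trans (lt_half _)).
have [F0|[A AF]] := set_0Vmem F.
  rewrite F0 cards0 leqn0 cards_eq0; apply/eqP/setP=> Y; rewrite !inE.
  apply/negbTE/negP=> /strongly_shatteredP[T _ /(_ set0 (sub0set _))].
  by rewrite inE.
have F1 : #|F| = 1 by apply/eqP; rewrite eqn_leq le1; apply/card_gt0P; exists A.
have /cards1P[B eF] : #|F| == 1 by rewrite F1.
rewrite F1 -(cards1 (set0 : {set X})); apply: subset_leq_card.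
apply/subsetP=> Y; rewrite !inE => /strongly_shatteredP[T TY sY].
rewrite -subset0; apply/subsetP=> y yY.
have := sY _ (sub0set _); have := sY Y (subxx _); rewrite eF !inE set0U => /eqP <- /eqP eT.
by have := subsetP TY y; rewrite eT !inE yY => /(_ isT).
Qed.

(** By [card_le_shattered] this is an equality; halves inherit it by counting alone. *)
Definition tight F := #|shattered_sets F| <= #|F|.

Lemma extremal_tight F : extremal F -> tight F.
Proof.
move=> eF; apply: leq_trans (card_strongly_shattered_le F).
by apply: eq_leq; apply: eq_card => Y; rewrite !inE eF.
Qed.

(** The inequalities of the two halves add up, so equality for [F] leaves no slack in either. *)
Lemma tight_half F x b : tight F -> tight (half F x b).
Proof.
rewrite /tight => tF; have := leq_trans (card_shattered_halves F x) tF.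
rewrite (card_half F x); case: b => le.
  rewrite -(leq_add2l #|half F x false|); apply: leq_trans le.
  by rewrite leq_add2r card_le_shattered.
rewrite -(leq_add2r #|half F x true|); apply: leq_trans le.
by rewrite leq_add2l card_le_shattered.
Qed.

Lemma tight_subcube F (A : {set X}) (s : seq X) :
  tight F -> tight [set C : {set X} in F | all (fun x => (x \in C) == (x \in A)) s].
Proof.
move=> tF; elim: s => [|x s IHs] /=; first by rewrite setIdE setIT.
have -> : [set C : {set X} in F | ((x \in C) == (x \in A)) && all (fun x => (x \in C) == (x \in A)) s]
    = half [set C : {set X} in F | all (fun x => (x \in C) == (x \in A)) s] x (x \in A).
  by apply/setP=> C; rewrite !inE [X in _ && X]andbC andbA.
exact: tight_half.
Qed.

Lemma pair_not_tight (A B : {set X}) x y : x != y ->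
  (x \in A) != (x \in B) -> (y \in A) != (y \in B) -> ~~ tight [set A; B].
Proof.
move=> nxy xAB yAB; rewrite /tight -ltnNge.
have sh z : (z \in A) != (z \in B) -> shattered [set A; B] [set z].
  move=> zAB; apply/shatteredP=> Z; rewrite subset1.
  pose C := if (z \in A) == (z \in Z) then A else B.
  have CAB : C \in [set A; B] by rewrite /C; case: ifP; rewrite !inE eqxx ?orbT.
  move=> Zz; exists C => //.
  have zC : (z \in C) = (z \in Z).
    by rewrite /C; case: ifP => [/eqP //|]; case: (z \in A) (z \in B) (z \in Z) zAB => [] [] [].
  case/orP: Zz zC => /eqP->; rewrite !inE ?eqxx => zC.
    by apply/setP=> w; rewrite !inE; have [->|] := eqVneq w z; rewrite ?andbF ?zC.
  by apply/setP=> w; rewrite !inE; have [->|] := eqVneq w z; rewrite ?andbF ?zC.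
have -> : #|[set A; B]| = 2.
  by rewrite cards2 (_ : A != B) //; apply: contraNneq xAB => ->.
have sub : [set set0; [set x]; [set y]] \subset shattered_sets [set A; B].
  rewrite !subUset !sub1set !inE (sh x) // (sh y) // !andbT.
  by apply/shatteredP=> Z; rewrite subset0 => /eqP->; exists A; rewrite ?setI0 // !inE eqxx.
apply: leq_trans (subset_leq_card sub).
rewrite setUC cardsU1 cards2 !inE negb_or (eq_sym set0) -!cards_eq0 !cards1 /=.
by rewrite (inj_eq set1_inj) eq_sym nxy.
Qed.

(* If [A] and [B] differ in two elements, the subcube they span contains a
   third member, since the two alone are shattered on three sets. *)
Lemma tight_graded F : tight F -> graded (@inc _ F).
Proof.
move=> tF A B c; have [n] := ubnP (hdist (@inc _ F) A B).
elim: n B c => // n IHn B c le_n ne.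
have [/existsP[d /andP[ndc dAB]] | /existsPn same] :=
    boolP [exists d, (d != c) && (inc A d != inc B d)]; last first.
  exists B, c; split=> // d; have [->|ndc] := eqVneq d c.
    by move: ne; case: (inc A c) (inc B c) => [] [].
  by move: (same d); rewrite ndc addbF /= negbK => /eqP.
pose s := [seq x <- enum X | inc A x == inc B x].
have := tight_subcube (val A) s tF; set G := [set _ in F | _] => tG.
have inG C : C \in F -> (forall x, inc A x = inc B x -> (x \in C) = inc A x) -> C \in G.
  move=> CF CA; rewrite inE CF; apply/allP=> x; rewrite mem_filter => /andP[/eqP xs _].
  by rewrite CA.
have AG : val A \in G by apply: inG; rewrite ?(valP A).
have BG : val B \in G by apply: inG; rewrite ?(valP B) // => x ->.
have AB : [set val A; val B] \subset G by rewrite subUset !sub1set AG.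
have [eG|] := boolP (G \subset [set val A; val B]).
  have := pair_not_tight ndc dAB ne; rewrite (_ : [set _; _] = G) ?tG //.
  by apply/eqP; rewrite eqEsubset AB.
case/subsetPn=> C; rewrite inE => /andP[CF /allP Cs].
rewrite !inE negb_or => /andP[nCA nCB].
have {}Cs x : inc A x = inc B x -> inc (vert CF) x = inc A x.
  by move=> xs; apply/eqP/Cs; rewrite mem_filter xs eqxx mem_enum.
have [x Cx] : exists x, inc A x != inc (vert CF) x.
  apply/existsP; rewrite -negb_forall; apply: contra nCA => /forallP hAC.
  by apply/eqP/setP=> x; move/eqP/esym: (hAC x).
have [y By] : exists y, inc B y != inc (vert CF) y.
  apply/existsP; rewrite -negb_forall; apply: contra nCB => /forallP hAC.
  by apply/eqP/setP=> z; move/eqP/esym: (hAC z).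
(* [C] lies between [A] and [B] and is nearer to [A] than [B] is; a step from [A] towards [C] is
   also one towards [B]. *)
have [|t [e [At te]]] := IHn (vert CF) x _ Cx.
  rewrite -ltnS; apply: leq_trans le_n; rewrite ltnS; apply/proper_card/properP; split.
    by apply/subsetP=> z; rewrite !inE; apply: contraNneq => /Cs ->.
  have nAB : inc A y != inc B y by apply: contraNneq By => e; rewrite (Cs _ e) e.
  exists y; rewrite inE // negbK; apply/eqP.
  by move: nAB By; case: (inc A y) (inc B y) (inc (vert CF) y) => [] [] [].
exists t, e; split=> //.
have neC : inc A e != inc (vert CF) e by rewrite -te (stepE At); case: (inc A e).
have neB : inc A e != inc B e by apply: contraNneq neC => /Cs ->.
by rewrite (stepE At); case: (inc A e) (inc B e) neB => [] [].
Qed.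

End Extremal.

(** * Full chains and starlike systems *)

Section FullChain.
Variables (X : finType) (F : {set {set X}}).

Lemma chain_link_step (A C : vertex F) :
  (val A \subset val C) && (#|val C :\: val A| == 1) ->
  exists2 x, step (@inc _ F) A C x & ~~ inc A x.
Proof.
case/andP=> hAC /cards1P[x eCA]; exists x; last first.
  by have := set11 x; rewrite -eCA inE => /andP[].
suff /one_inclusionP[] : one_inclusion A C x by [].
rewrite /one_inclusion; have := set11 x; rewrite -eCA inE => /andP[-> _] /=.
by rewrite -{1}(setID (val C) (val A)) (setIidPr hAC) eCA setUC.
Qed.

Lemma full_chain_graded : full_chain F -> row_chain (@inc _ F) /\ graded (@inc _ F).
Proof.
case=> s [sF sS].
have in_s (A : vertex F) : val A \in s by rewrite (perm_mem sF) mem_enum (valP A).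
have in_F i : i < size s -> nth set0 s i \in F.
  by move=> lt_i; rewrite -mem_enum -(perm_mem sF) mem_nth.
have sub i j : i <= j -> j < size s -> nth set0 s i \subset nth set0 s j.
  move=> le_ij lt_j.
  apply: (sorted_leq_nth (leT := fun A B : {set X} => A \subset B)) => //.
  - by move=> B A C; apply: subset_trans.
  - by move: sS; apply: sub_sorted => A B /andP[].
  - by rewrite inE (leq_ltn_trans le_ij).
have idx (A : vertex F) : index (val A) s < size s by rewrite index_mem.
have nthA (A : vertex F) : nth set0 s (index (val A) s) = val A by rewrite nth_index.
have link i : i.+1 < size s ->
    (nth set0 s i \subset nth set0 s i.+1) && (#|nth set0 s i.+1 :\: nth set0 s i| == 1).
  by move/sortedP: sS; apply.
split=> [A B | A B c ne].
  have subI (A' B' : vertex F) : index (val A') s <= index (val B') s -> inc A' \subset inc B'.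
    move=> le; apply/subsetP=> c; have := sub _ _ le (idx B'); rewrite !nthA => /subsetP.
    exact.
  by case: (leqP (index (val A) s) (index (val B) s)) => [|/ltnW] /subI; [left | right].
case: (ltngtP (index (val A) s) (index (val B) s)) => [lt | lt | e].
- have lt1 := leq_ltn_trans lt (idx B).
  have := link _ lt1; rewrite nthA => /(chain_link_step (C := vert (in_F _ lt1)))[x st nx].
  exists (vert (in_F _ lt1)), x; split=> //; rewrite (stepE st) nx.
  have := sub _ _ lt (idx B); rewrite nthA => /subsetP/(_ x); rewrite /inc => -> //.
  by have := stepE st; rewrite nx.
- case eA: (index (val A) s) lt => [//|i]; rewrite ltnS => le.
  have lt1 : i.+1 < size s by rewrite -eA idx.
  have lt0 := ltnW lt1.
  have := link _ lt1; rewrite -eA nthA => /(chain_link_step (A := vert (in_F _ lt0)))[x st nx].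
  exists (vert (in_F _ lt0)), x; split; first exact: step_sym.
  rewrite (negPf nx); apply/esym/negbTE; apply: contra nx.
  by have := sub _ _ le lt0; rewrite nthA => /subsetP; apply.
by move: ne; rewrite (_ : A = B) ?eqxx //; apply: val_inj; rewrite /= -nthA e nthA.
Qed.

(** Sort by cardinality, which is injective on a chain. For consecutive [A] and [B], a step from [A]
    towards [B] gives a member of size [#|A|.+1] inside [B]. *)
Lemma graded_full_chain : row_chain (@inc _ F) -> graded (@inc _ F) -> full_chain F.
Proof.
move=> ch gF; pose s := sort (fun A B : {set X} => #|A| <= #|B|) (enum F).
have sF : perm_eq s (enum F) by rewrite perm_sort.
have in_s A : (A \in s) = (A \in F) by rewrite (perm_mem sF) mem_enum.
have chF A B : A \in F -> B \in F -> A \subset B \/ B \subset A.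
  by move=> AF BF; case: (ch (vert AF) (vert BF)) => /subsetP AB; [left | right]; apply/subsetP.
have cardI : {in s &, injective (fun A : {set X} => #|A|)}.
  move=> A B; rewrite !in_s => AF BF e; apply/eqP.
  case: (chF _ _ AF BF) => /subset_leqif_cards[_]; rewrite e eqxx => /esym //.
  by rewrite eq_sym.
have sS : sorted (fun A B : {set X} => #|A| < #|B|) s.
  rewrite -(sorted_map (e' := ltn) (f := fun A : {set X} => #|A|)) ltn_sorted_uniq_leq.
  rewrite map_inj_in_uniq // (perm_uniq sF) enum_uniq sorted_map.
  by apply: sort_sorted => A B; apply: leq_total.
have lt_nth i j : i < size s -> j < size s -> (i < j) = (#|nth set0 s i| < #|nth set0 s j|).
  have tr : transitive (fun A B : {set X} => #|A| < #|B|) by move=> B A C; apply: ltn_trans.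
  move=> li lj; have lt := sorted_ltn_nth tr set0 sS; case: (ltngtP i j) => [ij | ji | ->].
  - by rewrite lt.
  - by rewrite ltnNge ltnW ?lt.
  - by rewrite ltnn.
exists s; split=> //; apply/(sortedP set0) => i lt1; have lt0 := ltnW lt1.
set A := nth set0 s i; set B := nth set0 s i.+1.
have AF : A \in F by rewrite -in_s mem_nth.
have BF : B \in F by rewrite -in_s mem_nth.
have ltAB : #|A| < #|B| by rewrite -lt_nth.
have AB : A \subset B.
  by case: (chF _ _ AF BF) => // /subset_leq_card; rewrite leqNgt ltAB.
have /subsetPn[x xB xA] : ~~ (B \subset A).
  by apply: contraL ltAB => /subset_leq_card; rewrite -leqNgt.
have [|C [y [hAC Cy]]] := gF (vert AF) (vert BF) x.
  by rewrite /inc /= (negPf xA) xB.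
have yA : y \notin A.
  apply/negP=> yA; have := stepE hAC; rewrite Cy /inc /= yA.
  by rewrite (subsetP AB).
have eC : val C = y |: A.
  have /one_inclusionP/andP[_ /eqP //] : step (@inc _ F) (vert AF) C y /\ ~~ inc (vert AF) y by [].
have yB : y \in B by move: Cy; rewrite /inc eC setU11.
have CB : val C \subset B by rewrite eC subUset sub1set yB.
have Cs : val C \in s by rewrite in_s (valP C).
have ltC : index (val C) s < size s by rewrite index_mem.
have nC : nth set0 s (index (val C) s) = val C by rewrite nth_index.
have cC : #|val C| = #|A|.+1 by rewrite eC cardsU1 yA.
(* [C] comes after position [i] but not after [i.+1], so it is [B]. *)
have h1 : i < index (val C) s by rewrite lt_nth // nC cC.
have h2 : ~~ (i.+1 < index (val C) s).
  by rewrite lt_nth // nC -leqNgt subset_leq_card.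
have e : index (val C) s = i.+1 by apply/eqP; rewrite eqn_leq leqNgt h2.
have -> : B = y |: A by rewrite -eC -nC e.
rewrite subsetUr /= setDUl setDv setU0; apply/cards1P; exists y.
by apply/setP=> d; rewrite !inE; have [->|] := eqVneq d y; rewrite ?yA ?andbF.
Qed.

End FullChain.

(** * Starlike systems and gradedness *)

Section Star.
Variables (X : finType) (F : {set {set X}}).
Local Notation M := (@inc _ F).

Lemma step_row_uniq (A B C : vertex F) c : step M A B c -> step M A C c -> B = C.
Proof. by move=> AB hAC; apply: inc_inj => d; rewrite AB hAC. Qed.

Lemma step_label_uniq (A B : vertex F) c d : step M A B c -> step M A B d -> c = d.
Proof.
move=> /(_ c) ABc /(_ c) ABd; apply/eqP; move: ABd; rewrite ABc eqxx.
by case: (M A c) (c == d) => [] [].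
Qed.

Lemma graded_distinct_labels : graded (transpose M) -> distinct_labels (@one_inclusion _ F).
Proof.
move=> gT A B A' B' b /one_inclusionP[AB bA] /one_inclusionP[AB' bA'].
have eA : A = A'.
  by apply: inc_inj; apply: (graded_label gT AB AB'); rewrite (negPf bA) (negPf bA').
by subst A'; split=> //; apply: step_row_uniq AB AB'.
Qed.

Lemma graded_connected : graded M -> connected (inclusion_graph F).
Proof.
by move=> gF A B; have [p [gp lp _]] := graded_walk A B gF; apply/connectP; exists p.
Qed.

(* [b = false] gives the upward and [b = true] the downward starlike systems. *)
Variable (b : bool).

Definition const_row (m : vertex F) := forall c, M m c = b.
Definition const_col (z : X) := forall A, M A z = b.
Definition centre (m : vertex F) :=
  if b then sink (inclusion_graph F) m else source (inclusion_graph F) m.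

Section FromGraded.
Variables (m m1 m2 : vertex F) (a1 a2 z : X).
Hypotheses (gF : graded M) (gT : graded (transpose M)).
Hypotheses (row_m : const_row m) (col_z : const_col z).
Hypotheses (s1 : step M m m1 a1) (s2 : step M m m2 a2) (na : a1 != a2).

(** Two edges in the same direction would make [A] a turn, hence a constant row; column [z] forces
    its value to be [b], so [A] would be [m]. *)
Lemma neighbour_uniq A B C x y : A != m -> step M A B x -> step M A C y ->
  M A x = M A y -> B = C.
Proof.
move=> nAm AB hAC e; have [exy|nxy] := eqVneq x y.
  by subst y; apply: step_row_uniq AB hAC.
have Ac := graded_turn gT AB hAC nxy e.
case/eqP: nAm; apply: inc_inj => c.
by rewrite row_m Ac -(Ac z) col_z.
Qed.

Lemma star_degree A : A != m -> degree (inclusion_graph F) A <= 2.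
Proof.
move=> nAm; rewrite /degree; set N := [set B | _].
(* A neighbour is determined by the direction of its edge, so [N] embeds into [bool]. *)
rewrite -card_bool -(card_in_imset (f := fun B : vertex F => val A \subset val B) (D := N)).
  exact: max_card.
have dir B x : step M A B x -> (val A \subset val B) = ~~ M A x.
  move=> AB; apply/idP/idP => [/subsetP/(_ x) sub | nx].
    by apply/negP=> Ax; have := stepE AB; rewrite Ax /inc sub.
  apply/subsetP=> c Ac; rewrite -[_ \in _]/(M B c) (step_neq AB) //.
  by apply: contraNneq nx => <-.
move=> B C; rewrite !inE => /adjP[x AB] /adjP[y hAC].
rewrite (dir _ _ AB) (dir _ _ hAC) => e; apply: neighbour_uniq AB hAC _ => //.
by apply: negb_inj.
Qed.

(* A vertex of a cycle farthest from the centre has two distinct neighbours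
   that are not farther. *)
Lemma star_acyclic : acyclic (inclusion_graph F).
Proof.
move=> c cyc un; rewrite leqNgt; apply/negP=> lt2.
have [u0 u0c] : exists u, u \in c by case: c lt2 {cyc un} => // u c; exists u; rewrite mem_head.
case: (@arg_maxnP _ u0 (fun u => u \in c) (fun u => hdist M u m) u0c) => u uc umax.
have [i p ep] := rot_to uc.
have {}cyc : cycle (adj (inclusion_graph F)) (u :: p) by rewrite -ep rot_cycle.
have {}un : uniq (u :: p) by rewrite -ep rot_uniq.
have sz : 2 < size (u :: p) by rewrite -ep size_rot.
have {}umax w : w \in u :: p -> hdist M w m <= hdist M u m.
  by rewrite -ep mem_rot => /umax.
case: p ep cyc un sz umax => [|w1 [|w2 p]] // ep cyc un _ umax.
have [uw1 wu] : adj (inclusion_graph F) u w1 /\ adj (inclusion_graph F) u (last w2 p).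
  move: cyc; rewrite /= rcons_path => /and4P[-> _ _]; rewrite /adj orbC => ->.
  by [].
have toward w : w \in u :: w1 :: w2 :: p -> adj (inclusion_graph F) u w ->
    exists2 x, step M u w x & M u x = ~~ b.
  move=> wc /adjP[x uw]; exists x => //.
  have [Mwx|] := eqVneq (M w x) b; first by rewrite -Mwx (stepE uw) negbK.
  move=> Mwx; have := umax _ wc; have e : M u x = M m x.
    by move: Mwx; rewrite row_m (stepE uw); case: (M u x) b => [] [].
  by rewrite (hdist_step (step_sym uw) e) ltnn.
have w2c : last w2 p \in w2 :: p by apply: mem_last.
have [|x ux ex] := toward w1 _ uw1; first by rewrite !inE eqxx orbT.
have [|y uy ey] := toward (last w2 p) _ wu; first by rewrite 2!in_cons w2c !orbT.
have num : u != m.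
  by apply/eqP=> e; move: ex; rewrite e row_m; case: b.
have e : w1 = last w2 p by apply: neighbour_uniq ux uy _; rewrite ?ex ?ey.
by move: un; rewrite /= e w2c andbF.
Qed.

(** The distance to [m] counts the entries different from [b], and every arc turns one entry from
    false to true. *)
Lemma graded_centre : centre m.
Proof.
have key A B k l : inclusion_graph F A B -> dist (inclusion_graph F) A m k ->
    dist (inclusion_graph F) B m l -> if b then l < k else k < l.
  move=> /arcP[x [AB nx]] dA dB.
  rewrite (dist_uniq dA (graded_dist A m gF)) (dist_uniq dB (graded_dist B m gF)).
  case eb: b.
    by rewrite (hdist_step AB) // row_m eb (stepE AB) nx.
  by rewrite [X in _ < X](hdist_step (step_sym AB)) // row_m eb (negPf nx).
rewrite /centre; case: b key => key; split; try exact: graded_connected; exact: key.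
Qed.

Lemma graded_starlike : starlike_at (@one_inclusion _ F) m.
Proof.
split.
- by split; [apply: graded_connected | apply: star_acyclic].
- exact: graded_distinct_labels.
- have n12 : m1 != m2.
    by apply: contraNneq na => e; subst m2; apply/eqP; apply: step_label_uniq s1 s2.
  have e2 : #|[set m1; m2]| = 2 by rewrite cards2 n12.
  rewrite -[X in X <= _]e2; apply: subset_leq_card.
  rewrite subUset !sub1set !inE; apply/andP; split; apply/adjP; first by exists a1.
  by exists a2.
- by have := graded_centre; rewrite /centre; case: b; [right | left].
exact: star_degree.
Qed.

End FromGraded.

(** Complementing by [b] turns the centre into the empty row and reduces both cases to star
    matrices. *)
Lemma starlike_graded m z : const_row m -> const_col z ->
  starlike_at (@one_inclusion _ F) m -> centre m -> graded M /\ graded (transpose M).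
Proof.
move=> row_m col_z [[conn _] lab _ _ deg] ctr.
pose N := xor_const b M.
have inj : row_inj N by move=> A B AB; apply: inc_inj => c; apply: (@addIb b); apply: AB.
have row0 c : ~~ N m c by rewrite /N /xor_const row_m addbb.
have col0 A : ~~ N A z by rewrite /N /xor_const col_z addbb.
(* Take the first edge of a shortest path from [A] to [m]; the source or sink condition fixes its
   direction. *)
have acc A : A != m -> exists B x, step N B A x /\ ~~ N B x.
  move=> nAm; have [[|k] dA] := connected_dist A m conn.
    by case: dA => -[[|? ?] [//= _ e _]] _; rewrite e eqxx in nAm.
  have [B /adjP[x AB] dB] := dist_step dA.
  exists B, x; split; first exact/step_xor/step_sym.
  apply/negP; rewrite /N /xor_const => Bx; have Ax := stepE (step_sym AB).
  move: ctr Bx; rewrite /centre; case: b => -[_ ctr].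
    rewrite addbT => Bx; have /ctr/(_ dB dA) : inclusion_graph F B A.
      by apply/arcP; exists x; split=> //; apply: step_sym.
    by rewrite ltnNge leqnSn.
  rewrite addbF => Bx; have /ctr/(_ dA dB) : inclusion_graph F A B.
    by apply/arcP; exists x; split=> //; rewrite Ax Bx.
  by rewrite ltnNge leqnSn.
have labN A B A' B' x : step N A B x -> step N A' B' x -> ~~ N A x -> ~~ N A' x -> B = B'.
  move=> /step_xor AB /step_xor AB'; rewrite /N /xor_const; case: b.
    rewrite !addbT !negbK => Ax Ax'.
    have BA : one_inclusion B A x.
      by apply/one_inclusionP; split; [apply: step_sym | rewrite (stepE AB) Ax].
    have BA' : one_inclusion B' A' x.
      by apply/one_inclusionP; split; [apply: step_sym | rewrite (stepE AB') Ax'].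
    by have [] := lab _ _ _ _ _ BA BA'.
  rewrite !addbF => Ax Ax'; have [] // := lab A B A' B' x.
    exact/one_inclusionP.
  exact/one_inclusionP.
(* Two upward neighbours together with the neighbour [C] below [A] would exceed the degree bound. *)
have up A B B' x x' : A != m -> step N A B x -> step N A B' x' ->
    ~~ N A x -> ~~ N A x' -> B = B'.
  move=> nAm AB AB' Ax Ax'; apply/eqP/negPn/negP => nBB'.
  have [C [y [CA Cy]]] := acc A nAm; move/step_xor/step_sym: CA => hAC.
  have Ay : N A y by move: Cy; rewrite /N /xor_const (stepE hAC); case: (M A y) b => [] [].
  have nCB D w : step N A D w -> ~~ N A w -> C != D.
    move=> AD; apply: contraNneq => e; subst D.
    by move/step_xor: AD => AD; rewrite (step_label_uniq AD hAC).
  have := deg A nAm; rewrite leqNgt => /negP; apply.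
  have -> : 3 = #|[set C; B; B']|.
    by rewrite setUC cardsU1 cards2 !inE negb_or eq_sym (nCB _ _ AB') // eq_sym nBB' (nCB _ _ AB).
  apply: subset_leq_card; rewrite !subUset !sub1set !inE -andbA.
  apply/and3P; split; apply/adjP.
  - by exists y.
  - by exists x; move/step_xor: AB.
  - by exists x'; move/step_xor: AB'.
split.
  by apply/(graded_xor M b); apply: star_graded row0 acc labN.
by apply/(graded_xor (transpose M) b); apply: star_graded_transpose row0 col0 acc labN up.
Qed.

End Star.

(** * Equivalence of gradedness in both directions with the three structures *)

Section Structure.
Variables (X : finType) (F : {set {set X}}).
Local Notation M := (@inc _ F).

Lemma const_row_val b (m : vertex F) :
  const_row b m <-> val m = if b then setT else set0.
Proof.
split=> [row | e c]; last by rewrite /inc e; case: b {e}; rewrite inE.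
by apply/setP=> c; rewrite -[_ \in _]/(M m c) row; case: b {row}; rewrite inE.
Qed.

Lemma const_col_mem b z :
  const_col F b z <-> forall A, A \in F -> (z \in A) = b.
Proof.
split=> [col A AF | col A]; first exact: col (vert AF).
exact: col (valP A).
Qed.

Lemma graded_structure : graded M -> graded (transpose M) ->
  full_chain F \/ upward_starlike F \/ downward_starlike F.
Proof.
move=> gF gT.
have [/forallP ch | ] :=
    boolP [forall A, forall B, (M A \subset M B) || (M B \subset M A)].
  by left; apply: graded_full_chain => // A B; apply/orP; move/forallP: (ch A).
rewrite negb_forall => /existsP[A]; rewrite negb_forall => /existsP[B].
rewrite negb_or => /andP[/subsetPn[x Ax Bx] /subsetPn[y By Ay]].
have {Ax Bx}[Ax Bx] : M A x /\ ~~ M B x by [].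
have {Ay By}[Ay By] : ~~ M A y /\ M B y by [].
have [||| m [m1 [m2 [a1 [a2 [s1 s2 na e12]]]]]] := @incomparable_turn _ _ M A B x y gF.
- by rewrite Ax (negPf Bx).
- by rewrite By (negPf Ay).
- by rewrite Ax (negPf Ay).
have row := graded_turn gT s1 s2 na e12.
have m1a2 : M m1 a2 = M m a1 by rewrite (step_neq s1) ?row // eq_sym.
have m2a1 : M m2 a1 = M m a1 by rewrite (step_neq s2).
have m1a1 := stepE s1; have m2a2 := stepE s2; rewrite row in m2a2.
(* In rows [m1] and [m2] columns [a1] and [a2] take opposite values, so they are incomparable and
   the same argument gives a constant column [z], with its value read off in row [m]. *)
have [||| z [z1 [z2 [A1 [A2 [t1 t2 nA eA]]]]]] :=
    @incomparable_turn _ _ (transpose M) a1 a2 m1 m2 gT; rewrite /transpose.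
- by rewrite m1a1 m1a2; case: (M m a1).
- by rewrite m2a1 m2a2; case: (M m a1).
- by rewrite m1a1 m2a1; case: (M m a1).
have col A' : M A' z = M m a1.
  have colz := graded_turn (M := transpose M) gF t1 t2 nA eA.
  by rewrite -(row z) [LHS]colz [RHS]colz.
have star := graded_starlike gF gT row col s1 s2 na.
have ctr := graded_centre gF row.
have /const_row_val vm := row; have /const_col_mem vz := col.
right; case: (M m a1) vm vz ctr {row col m1a1 m1a2 m2a1 m2a2 e12} star => vm vz ctr star; [right | left].
all: split; first by exists m.
  by exists z => C /vz ->.
by exists z => C /vz ->.
Qed.

Lemma structure_graded :
  full_chain F \/ upward_starlike F \/ downward_starlike F ->
  graded M /\ graded (transpose M).
Proof.
case=> [fc | [[[m [vm star ctr]] [z zF]] | [[m [vm star ctr]] [z zF]]]].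
- have [ch gF] := full_chain_graded fc; split=> //.
  exact: chain_graded_transpose (@inc_inj _ F) ch gF.
- apply: (@starlike_graded _ F false m z) => //; first exact/const_row_val.
  by apply/const_col_mem=> A /zF/negPf.
apply: (@starlike_graded _ F true m z) => //; first exact/const_row_val.
by apply/const_col_mem=> A /zF.
Qed.

Lemma graded_dual_no_shattered_pair :
  graded M -> graded (transpose M) -> no_shattered_pair (@inc _ (dual_system F)).
Proof.
move=> gF gT A B r00 r01 r10 r11.
have [x00 ->] := dual_col_surj r00; have [x01 ->] := dual_col_surj r01.
have [x10 ->] := dual_col_surj r10; have [x11 ->] := dual_col_surj r11.
rewrite !inc_dual_col; exact: (graded_no_shattered_pair (M := transpose M)).
Qed.

Lemma self_and_dual_gradedP :
  self_and_dual well_graded F <-> graded M /\ graded (transpose M).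
Proof.
rewrite /self_and_dual; split=> -[].
  by move=> /well_gradedP gF /well_gradedP/dual_gradedP.
by move=> gF gT; split; apply/well_gradedP => //; apply/dual_gradedP.
Qed.

Lemma self_and_dual_extremalP :
  self_and_dual extremal F <-> graded M /\ graded (transpose M).
Proof.
split=> [[eF eD] | [gF gT]].
  by split; [|apply/dual_gradedP]; apply/tight_graded/extremal_tight.
split; apply: graded_extremal => //.
- exact: graded_no_shattered_pair.
- exact/dual_gradedP.
- exact: graded_dual_no_shattered_pair.
Qed.

End Structure.

(** * Maximum systems *)

Section Maximum.
Variable X : finType.
Implicit Types F : {set {set X}}.

Lemma has_vc_dim_ex F : F != set0 -> exists d, has_vc_dim F d.
Proof.
case/set0Pn=> A AF.
have sh0 : shattered F set0.
  by apply/shatteredP=> Z; rewrite subset0 => /eqP->; exists A; rewrite ?setI0.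
case: (@arg_maxnP _ set0 (shattered F) (fun Y => #|Y|) sh0) => Y shY maxY.
by exists #|Y|; split; [exists Y | move=> Z /maxY].
Qed.

Lemma maximum_card F d : maximum F -> has_vc_dim F d ->
  #|F| = \sum_(0 <= i < d.+1) 'C(#|X|, i).
Proof.
move=> mF dF; have := mF d dF setT; rewrite cardsT => <-.
by rewrite /trace (eq_imset (g := id)) ?imset_id // => A; rewrite setIT.
Qed.

(** VC-dimension zero allows one member; otherwise the first two binomial coefficients already give
    [1 + #|X|]. *)
Lemma maximum_card_gt F : F != set0 -> maximum F -> #|F| = 1 \/ #|X| < #|F|.
Proof.
move=> F0 mF; have [d dF] := has_vc_dim_ex F0; rewrite (maximum_card mF dF).
case: d {dF} => [|d]; [left | right]; first by rewrite big_nat1 bin0.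
by rewrite big_nat_recl // big_nat_recl // bin0 bin1 add1n ltnS leq_addr.
Qed.

Lemma card1_maximum F : #|F| = 1 -> maximum F.
Proof.
move/eqP/cards1P=> [A ->] d [[Y sY <-] _] Z.
have trA W : trace [set A] W = [set A :&: W] by rewrite /trace imset_set1.
have : #|powerset Y| = 1 by rewrite -(eqP sY) trA cards1.
rewrite card_powerset; case: #|Y| => [_|n]; first by rewrite big_nat1 bin0 trA cards1.
by rewrite expnS mul2n; case: (2 ^ n).
Qed.

Lemma full_maximum F : #|X| = 1 -> F = setT -> maximum F.
Proof.
move=> X1 -> d [[Y sY eY] dmax] Z.
have sh W : trace [set: {set X}] W = powerset W.
  apply/eqP/shatteredP => V VW; exists V; rewrite ?inE //; exact/setIidPl.
have d1 : d = 1.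
  apply/eqP; rewrite eqn_leq -{1}eY -{1}X1 max_card /= -X1 -cardsT.
  by apply: dmax; rewrite /shattered sh.
rewrite sh card_powerset d1 big_nat_recl // big_nat1 bin0 bin1.
have : #|Z| <= 1 by rewrite -X1 max_card.
by case: #|Z| => [|[]].
Qed.

(** This family arises as the dual of a system with empty domain; it shatters nothing. *)
Lemma empty_maximum : maximum (set0 : {set {set X}}).
Proof. by move=> d [[Y /shatteredP/(_ set0 (sub0set _)) [A]]]; rewrite inE. Qed.

End Maximum.

Lemma card_vertex (X : finType) (F : {set {set X}}) : #|vertex F| = #|F|.
Proof. by rewrite card_sig; apply: eq_card => A; rewrite !inE. Qed.

(** If [F] has several members, then [#|X| < #|F|], so the dual has fewer members than its domain
    has elements and hence only one. All columns then agree, which leaves only [set0] and [setT] in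
    [F], and [#|X| < #|F| <= 2]. *)
Lemma maximumP (X : finType) (F : {set {set X}}) : F != set0 ->
  self_and_dual maximum F <-> #|F| = 1 \/ (F = [set set0; setT] /\ #|X| = 1).
Proof.
move=> F0; have leD : #|dual_system F| <= #|X| by rewrite -cardsT leq_imset_card.
have D0 (x : X) : dual_system F != set0 by apply/set0Pn; exists (val (dual_col F x)); apply: valP.
split=> [[mF mD] | [F1 | [eF X1]]].
- have [F1|nF1] := eqVneq #|F| 1; [by left | right].
  have F2 : 1 < #|F| by rewrite ltn_neqAle eq_sym nF1 card_gt0.
  have ltXF : #|X| < #|F| by case: (maximum_card_gt F0 mF) => // e; rewrite e eqxx in nF1.
  have [x _] := split_family F2.
  have D1 : #|dual_system F| == 1.
    case: (maximum_card_gt (D0 x) mD) => [->//|]; rewrite card_vertex.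
    by move/ltnW/(leq_trans ltXF); rewrite ltnNge leD.
  have same A y : A \in F -> (y \in A) = (x \in A).
    move=> AF; case/cards1P: D1 => C eD.
    have col w : val (dual_col F w) = C by apply/set1P; rewrite -eD (valP (dual_col F w)).
    have := inc_dual_col x (vert AF); have := inc_dual_col y (vert AF).
    by rewrite /inc !col => <- <-.
  have sub : F \subset [set set0; setT].
    apply/subsetP=> A AF; rewrite !inE; case xA: (x \in A); apply/orP; [right | left].
      by apply/eqP/setP=> y; rewrite same // xA inE.
    by apply/eqP/setP=> y; rewrite same // xA inE.
  have le2 : #|[set set0; [set: X]]| <= 2 by rewrite cards2; case: eqP.
  split; first by apply/eqP; rewrite eqEcard sub (leq_trans le2).
  apply/eqP; rewrite eqn_leq; apply/andP; split; last by apply/card_gt0P; exists x.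
  by rewrite -ltnS (leq_trans ltXF) // (leq_trans (subset_leq_card sub)).
- split; first exact: card1_maximum.
  have V1 : #|vertex F| = 1 by rewrite card_vertex.
  (* Over a one-point domain the dual is empty, a single set, or the full power set. *)
  have [->|nD0] := eqVneq (dual_system F) set0; first exact: empty_maximum.
  have [D1|nD1] := eqVneq #|dual_system F| 1; first exact: card1_maximum.
  apply: full_maximum => //; apply/eqP; rewrite eqEcard subsetT -powersetT card_powerset cardsT V1.
  by rewrite ltn_neqAle eq_sym nD1 card_gt0.
have [x _] : exists x : X, x \in X by apply/card_gt0P; rewrite X1.
split.
  apply: full_maximum => //; apply/eqP; rewrite eqEcard subsetT -powersetT card_powerset cardsT X1 eF.
  by rewrite cards2 eq_sym -card_gt0 cardsT X1.
apply: card1_maximum; apply/eqP; rewrite eqn_leq card_gt0 (D0 x) andbT.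
by rewrite -X1.
Qed.

Theorem corollary4p13 (X : finType) (F : {set {set X}}) (F_neq0 : F != set0) :
  ((self_and_dual extremal F <-> self_and_dual well_graded F) /\
   (self_and_dual well_graded F <->
      full_chain F \/ upward_starlike F \/ downward_starlike F)) /\
  (self_and_dual maximum F <->
     #|F| = 1 \/ (F = [set set0; setT] /\ #|X| = 1)).
Proof.
have wgP := self_and_dual_gradedP F.
split; last exact: maximumP.
split; first exact: iff_trans (self_and_dual_extremalP F) (iff_sym wgP).
split=> [/wgP[gF gT] | st]; first exact: graded_structure.
by apply/wgP; apply: structure_graded.
Qed.
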